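(* Let $\mathcal{C}$ be a clutter with a perfect matching $e_1,\ldots,e_g$ of König type. If for any two edges $f_1,f_2$ of $\mathcal{C}$ and for any edge $e_i$ of the perfect matching one has $f_1\cap e_i\subset f_2\cap e_i$ or $f_2\cap e_i\subset f_1\cap e_i$, then $\Delta_{\mathcal{C}}$ is pure shellable.
   Context: A clutter $\mathcal{C}$ with finite vertex set $X=\{x_1,\ldots,x_n\}$ is a family $E(\mathcal{C})$ of subsets of $X$, called edges, none of which is included in another. The edge ideal $I(\mathcal{C})$ is the ideal of the polynomial ring $R=K[x_1,\ldots,x_n]$ over a field $K$ generated by the monomials $\prod_{x_i\in e}x_i$, $e\in E(\mathcal{C})$; its height equals the minimum size of a vertex cover of $\mathcal{C}$ (a subset of $X$ meeting every edge). A perfect matching of König type of $\mathcal{C}$ is a collection $e_1,\ldots,e_g$ of pairwise disjoint edges whose union is $X$ and such that $g$ is the height of $I(\mathcal{C})$. $\Delta_{\mathcal{C}}$ is the simplicial complex on $X$ whose faces are the subsets of $X$ containing no edge of $\mathcal{C}$. A simplicial complex $\Delta$ is shellable if its facets can be ordered $F_1,\ldots,F_s$ such that for all $1\leq i<j\leq s$ there exist $v\in F_j\setminus F_i$ and $\ell\in\{1,\ldots,j-1\}$ with $F_j\setminus F_\ell=\{v\}$. It is pure if all its facets have the same dimension, and pure shellable if it is both pure and shellable. The symbol $\subset$ allows equality. *)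

(* Defs.v *)
From HB Require Import structures.
From mathcomp Require Import all_boot all_order all_algebra.
From mathcomp Require Import ring_quotient mpoly.

Set Implicit Arguments.
Unset Strict Implicit.
Unset Printing Implicit Defensive.

Import Order.TTheory GRing.Theory Num.Theory.
Local Open Scope ring_scope.

Section Height.
Variable R : comNzRingType.

(* Prime ideals are boolean predicates, as in ring_quotient; in classical
   logic every subset of R is of this form. *)
Definition prime_ideal (P : {pred R}) : Prop :=
  idealr_closed P /\ prime_idealr_closed P.

Definition strict_sub (P Q : {pred R}) : Prop :=
  {subset P <= Q} /\ ~ {subset Q <= P}.

(* A chain P_0 < P_1 < ... < P_k = P of k + 1 prime ideals has length k. *)
Definition prime_chain_to (P : {pred R}) (k : nat) : Prop :=
  exists c : 'I_k.+1 -> {pred R},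
    [/\ forall i, prime_ideal (c i),
        forall i j : 'I_k.+1, (i < j)%N -> strict_sub (c i) (c j)
      & c ord_max =i P].

Definition prime_height (P : {pred R}) (h : nat) : Prop :=
  prime_chain_to P h /\ forall k, prime_chain_to P k -> (k <= h)%N.

Definition prime_over (I : R -> Prop) (P : {pred R}) : Prop :=
  prime_ideal P /\ forall x, I x -> x \in P.

(* The least height of a prime ideal containing I. This is a relation: the
   unit ideal has no height, and a prime ideal of infinite height has no
   value h and hence does not affect the minimum. *)
Definition ideal_height (I : R -> Prop) (g : nat) : Prop :=
  (exists2 P, prime_over I P & prime_height P g) /\
  (forall P h, prime_over I P -> prime_height P h -> (g <= h)%N).

End Height.

Section Clutter.
Variable n : nat.
Implicit Types E : {set {set 'I_n}}.

Definition clutter E : Prop :=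
  {in E &, forall f1 f2 : {set 'I_n}, f1 \subset f2 -> f1 = f2}.

Definition edge_monomial (K : fieldType) (f : {set 'I_n}) : {mpoly K[n]} :=
  \prod_(i in f) 'X_i.

Definition edge_ideal (K : fieldType) E (p : {mpoly K[n]}) : Prop :=
  exists a : {set 'I_n} -> {mpoly K[n]},
    p = \sum_(f in E) a f * edge_monomial K f.

Definition konig_perfect_matching (K : fieldType) E (g : nat)
    (e : 'I_g -> {set 'I_n}) : Prop :=
  [/\ forall i, e i \in E,
      forall i j, i != j -> [disjoint e i & e j],
      \bigcup_i e i = [set: 'I_n]
    & ideal_height (@edge_ideal K E) g].

Definition independence_complex E : {set {set 'I_n}} :=
  [set F : {set 'I_n} | [forall f in E, ~~ (f \subset F)]].

End Clutter.

Section Shellable.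
Variable T : finType.
Implicit Types D : {set {set T}}.

Definition facets D : {set {set T}} :=
  [set F | maxset (fun G : {set T} => G \in D) F].

Definition face_dim (F : {set T}) : int := #|F|%:Z - 1.

Definition pure D : Prop :=
  {in facets D &, forall F G, face_dim F = face_dim G}.

Definition shelling D (s : seq {set T}) : Prop :=
  [/\ uniq s,
      s =i facets D
    & forall i j, (i < j < size s)%N ->
        exists v, v \in nth set0 s j :\: nth set0 s i /\
          exists2 l, (l < j)%N & nth set0 s j :\: nth set0 s l = [set v]].

Definition shellable D : Prop := exists s, shelling D s.

Definition pure_shellable D : Prop := pure D /\ shellable D.

End Shellable.

(* Main.v *)
Require Import Defs.
From mathcomp Require Import all_boot all_order all_algebra.
From mathcomp Require Import ring_quotient mpoly.

(** A facet of the independence complex is the complement of a minimal vertex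
    cover.  The comparability hypothesis says that, inside one matching edge
    [e i], the edges of the clutter cut out a chain of subsets.  Hence any two
    vertices of [e i] are comparable: one of them lies on every edge through
    the other ([dominates_total]).  A minimal vertex cover cannot contain both,
    since the dominated one would be redundant; as it must meet [e i], it
    contains exactly one vertex of each matching edge ([facet_missing]).  All
    minimal covers therefore have [g] elements, which is purity.

    For the shelling, number the vertices so that inside each [e i] smaller
    numbers dominate larger ones ([rank]).  A minimal cover becomes a tuple with
    one coordinate per matching edge, and the tuples that occur form a down-set
    of a product of chains: replacing a vertex by a dominating one keeps a cover
    ([exchange_face]).  Any linear extension of the product order then shells
    the complex, and comparing the sums of the ranks ([cover_weight]) gives one.
    Indeed, if [F1] comes before [F2], some coordinate of [F1] is smaller than
    that of [F2] ([smaller_coordinate]); lowering this single coordinate of [F2]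
    gives an earlier facet that misses exactly one vertex of [F2]. *)

Set Implicit Arguments.
Unset Strict Implicit.

(** * Domination between vertices *)

Section Domination.
Variables (n : nat) (E : {set {set 'I_n}}).
Implicit Types (F f : {set 'I_n}) (u v w : 'I_n).

Definition dominates u v : bool := [forall f in E, (v \in f) ==> (u \in f)].

Lemma dominatesP u v :
  reflect (forall f, f \in E -> v \in f -> u \in f) (dominates u v).
Proof.
apply: (iffP forall_inP) => H f fE; first by move=> vf; apply: (implyP (H f fE)).
by apply/implyP => vf; apply: H.
Qed.

Lemma faceP F :
  reflect (forall f, f \in E -> ~~ (f \subset F)) (F \in independence_complex E).
Proof. by rewrite inE; apply: forall_inP. Qed.

(** An edge inside the new set but not inside [F] would pass through [w], hence
    through [u], which has just been removed. *)
Lemma exchange_face F u w : F \in independence_complex E ->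
  dominates u w -> (w |: F) :\ u \in independence_complex E.
Proof.
move=> /faceP faceF /dominatesP duw; apply/faceP => f fE.
apply/negP => fsub; have [wf | wNf] := boolP (w \in f).
  by have := subsetP fsub _ (duw f fE wf); rewrite !inE eqxx.
case/negP: (faceF f fE); apply/subsetP => x xf.
have := subsetP fsub _ xf; rewrite !inE => /andP[_ /orP[/eqP xw|//]].
by rewrite -xw xf in wNf.
Qed.

(** The number of edges avoiding [v] decreases when [v] is replaced by a vertex
    that strictly dominates it; the term [v], which is less than [n], breaks the
    ties between vertices lying on the same edges. *)
Definition rank v : nat := #|[set f in E | v \notin f]| * n + v.

Lemma rank_inj : injective rank.
Proof.
move=> u v; rewrite /rank => /(congr1 (modn^~ n)).
by rewrite !modnMDl !modn_small // => /val_inj.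
Qed.

Lemma rank_dominates u v : dominates u v || dominates v u ->
  rank u <= rank v -> dominates u v.
Proof.
case/orP => // /dominatesP dvu le_uv.
set A := fun w => [set f in E | w \notin f].
have sAvu : A v \subset A u.
  apply/subsetP => f; rewrite !inE => /andP[fE vf]; rewrite fE /=.
  by apply: contra vf; apply: dvu.
have cAuv : #|A u| <= #|A v|.
  have n_gt0 : 0 < n by apply: leq_ltn_trans (ltn_ord u).
  have := leq_div2r n le_uv.
  by rewrite /rank !divnMDl // !divn_small // !addn0.
have/eqP eqA : A v == A u by rewrite eqEcard sAvu.
apply/dominatesP => f fE vf; apply: contraLR vf => uf.
by have : f \in A v; [rewrite eqA inE fE | rewrite inE fE].
Qed.

Definition cover_weight F : nat := \sum_(x in ~: F) rank x.

Lemma exchange_weight F u w : u \in F -> w \notin F ->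
  rank u < rank w -> cover_weight ((w |: F) :\ u) < cover_weight F.
Proof.
move=> uF wF lt_uw; rewrite /cover_weight.
rewrite [X in X < _](big_setD1 u) ?inE ?eqxx //=.
rewrite [X in _ < X](big_setD1 w) ?inE ?wF //=.
suff -> : ~: ((w |: F) :\ u) :\ u = ~: F :\ w by rewrite ltn_add2r.
apply/setP => x; rewrite !inE; have [->|] := eqVneq x u; first by rewrite uF andbF.
by rewrite /= negb_or.
Qed.

End Domination.

(** * Facets as transversals of the perfect matching *)

Section Matching.
Variables (n : nat) (E : {set {set 'I_n}}) (g : nat) (e : 'I_g -> {set 'I_n}).
Hypothesis eE : forall i, e i \in E.
Hypothesis e_disj : forall i j, i != j -> [disjoint e i & e j].
Hypothesis e_cover : \bigcup_i e i = [set: 'I_n].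
Hypothesis e_chain : forall f1 f2 : {set 'I_n}, f1 \in E -> f2 \in E ->
  forall i : 'I_g, f1 :&: e i \subset f2 :&: e i \/ f2 :&: e i \subset f1 :&: e i.

Implicit Types (F : {set 'I_n}) (u v w : 'I_n) (i j : 'I_g).

Local Notation Delta := (independence_complex E).

(** An edge through [v] but not [u] and an edge through [u] but not [v] would
    have incomparable traces on [e i]. *)
Lemma dominates_total i u v : u \in e i -> v \in e i ->
  dominates E u v || dominates E v u.
Proof.
move=> ui vi; apply/orP.
have [|/forall_inPn[f1 f1E]] := boolP (dominates E u v); first by left.
rewrite negb_imply => /andP[vf1 uf1]; right.
apply/dominatesP => f2 f2E uf2.
case: (e_chain f1E f2E i) => /subsetP sub.
  by have := sub v; rewrite !inE vf1 vi => /(_ isT) /andP[].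
by have := sub u; rewrite !inE uf2 ui (negPf uf1) => /(_ isT).
Qed.

(** If a facet missed two vertices of [e i], the dominated one could be added
    to it. *)
Lemma facet_missing F i : F \in facets Delta -> exists w, e i :\: F = [set w].
Proof.
rewrite inE => /maxsetP[faceF maxF].
have addF u w : dominates E w u -> w \notin F -> u != w -> u \in F.
  move=> dwu wF uw; have := exchange_face faceF dwu.
  have -> : (u |: F) :\ w = u |: F.
    apply/setP => x; rewrite !inE; case: (eqVneq x w) => //= ->.
    by rewrite (negPf wF) orbF eq_sym (negPf uw).
  by move/maxF => <-; rewrite ?setU11 ?subsetUr.
have /subsetPn[w wi wF] := faceP _ _ faceF _ (eE i).
exists w; apply/setP => u; rewrite !inE.
have [->|uw] := eqVneq u w; first by rewrite wF wi.
apply/negP => /andP[uF ui].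
case/orP: (dominates_total wi ui) => [dwu|duw].
  by rewrite (addF u w) in uF.
by rewrite (addF w u) // eq_sym in wF.
Qed.

Lemma in_matching x : exists i, x \in e i.
Proof.
have : x \in \bigcup_i e i by rewrite e_cover inE.
by case/bigcupP => i _ xi; exists i.
Qed.

(** A face missing a single vertex of each matching edge cannot be enlarged: a
    new vertex would complete the matching edge that contains it. *)
Lemma transversal_facet F : F \in Delta ->
  (forall i, exists w, e i :\: F = [set w]) -> F \in facets Delta.
Proof.
move=> faceF miss; rewrite inE; apply/maxsetP; split=> // G faceG sFG.
apply/eqP; rewrite eqEsubset sFG andbT; apply/subsetP => x xG.
apply/negPn/negP => xF; have [i xi] := in_matching x.
have [w ew] := miss i.
have /eqP xw : x == w by rewrite -in_set1 -ew !inE xF.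
case/negP: (faceP _ _ faceG _ (eE i)); apply/subsetP => y yi.
have [yF|yF] := boolP (y \in F); first exact: (subsetP sFG).
have /eqP -> : y == w by rewrite -in_set1 -ew !inE yF.
by rewrite -xw.
Qed.

Lemma sum_cover (h : 'I_n -> nat) F :
  \sum_(x in ~: F) h x = \sum_i \sum_(x in e i :\: F) h x.
Proof.
rewrite -partition_disjoint_bigcup => [|i j ij].
  apply: eq_bigl => x; rewrite inE; apply/idP/bigcupP => [xF|[i _]].
    by have [i xi] := in_matching x; exists i; rewrite // inE xF.
  by rewrite inE => /andP[].
by apply: disjointWl (subsetDl _ _) (disjointWr (subsetDl _ _) (e_disj ij)).
Qed.

Lemma card_facetC F : F \in facets Delta -> #|~: F| = g.
Proof.
move=> fF; rewrite -sum1_card sum_cover -[RHS]card_ord -sum1_card.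
apply: eq_bigr => i _; have [w ->] := facet_missing i fF.
by rewrite big_set1.
Qed.

Lemma pure_independence : pure Delta.
Proof.
move=> F G fF fG; suff cFG : #|F| = #|G| by rewrite /face_dim cFG.
have := cardsC F; rewrite -(cardsC G) !card_facetC //.
exact: addIn.
Qed.

(** * The shelling *)

(** If every coordinate of [F2] were at most that of [F1], comparing the sums
    would force equality in each coordinate. *)
Lemma smaller_coordinate F1 F2 : F1 \in facets Delta -> F2 \in facets Delta ->
  F1 != F2 -> cover_weight E F1 <= cover_weight E F2 ->
  exists i w1 w2, [/\ e i :\: F1 = [set w1], e i :\: F2 = [set w2]
                    & rank E w1 < rank E w2].
Proof.
move=> fF1 fF2 neF; rewrite /cover_weight !sum_cover => le12.
pose wt F i := \sum_(x in e i :\: F) rank E x.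
case: (boolP [exists i, wt F1 i < wt F2 i]) => [/existsP[i]|].
  have [w1 e1] := facet_missing i fF1; have [w2 e2] := facet_missing i fF2.
  by rewrite /wt e1 e2 !big_set1 => lt12; exists i, w1, w2.
rewrite negb_exists => /forallP ge21.
have leif21 i : true -> wt F2 i <= wt F1 i ?= iff (wt F2 i == wt F1 i).
  by move=> _; split=> //; rewrite leqNgt.
have [le21 eq21] := leqif_sum leif21.
move: eq21; rewrite eqn_leq le21 le12 => /esym/forall_inP eqwt.
case/eqP: neF; apply/setP => x; have [i xi] := in_matching x.
have [w1 e1] := facet_missing i fF1; have [w2 e2] := facet_missing i fF2.
have := eqwt i isT; rewrite /wt e1 e2 !big_set1 => /eqP/rank_inj w21.
have : (x \in e i :\: F1) = (x \in e i :\: F2) by rewrite e1 e2 w21.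
by rewrite !inE xi !andbT => /negb_inj.
Qed.

(** Lowering one coordinate of a minimal cover gives another minimal cover; the
    other coordinates do not move since the matching edges are disjoint. *)
Lemma exchange_facet F i u w : F \in facets Delta -> e i :\: F = [set w] ->
  u \in e i -> u != w -> dominates E u w -> (w |: F) :\ u \in facets Delta.
Proof.
move=> fF ew ui uw duw.
have faceF : F \in Delta by move: fF; rewrite inE => /maxsetP[].
apply: transversal_facet; first exact: exchange_face.
move=> j; have [<-|ij] := eqVneq i j.
  exists u; apply/setP => x.
  have := congr1 (fun A : {set 'I_n} => x \in A) ew; rewrite !inE.
  have [->|xu] := eqVneq x u; first by rewrite ui.
  by have [->|xw] := eqVneq x w; rewrite //= orFb => ->.
have [w' ew'] := facet_missing j fF; exists w'; rewrite -ew'.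
have wi : w \in e i by have := set11 w; rewrite -ew inE => /andP[].
apply/setP => x; rewrite !inE; have [xj|] := boolP (x \in e j); last by rewrite !andbF.
have xNi : x \notin e i by rewrite (disjointFl (e_disj ij)).
have -> : (x == u) = false by apply: contraNF xNi => /eqP->.
by have -> : (x == w) = false by apply: contraNF xNi => /eqP->.
Qed.

Lemma shellable_independence : shellable Delta.
Proof.
pose le_wt := relpre (cover_weight E) leq.
have le_wt_total : total le_wt by move=> F G; apply: leq_total.
have le_wt_trans : transitive le_wt by move=> F G H; apply: leq_trans.
pose s := sort le_wt (enum (facets Delta)).
have s_uniq : uniq s by rewrite sort_uniq enum_uniq.
have s_mem : s =i facets Delta by move=> F; rewrite mem_sort mem_enum.
have s_sorted a b : a < size s -> b < size s -> a <= b ->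
    cover_weight E (nth set0 s a) <= cover_weight E (nth set0 s b).
  move=> ha hb; apply: (sorted_leq_nth le_wt_trans) => //.
    by move=> F; apply: leqnn.
  exact: sort_sorted.
exists s; split=> // a b /andP[ab bs]; have as_ := ltn_trans ab bs.
set F1 := nth set0 s a; set F2 := nth set0 s b.
have fF1 : F1 \in facets Delta by rewrite -s_mem mem_nth.
have fF2 : F2 \in facets Delta by rewrite -s_mem mem_nth.
have neF : F1 != F2 by rewrite nth_uniq // neq_ltn ab.
have [i [u [w [e1 e2 lt_uw]]]] :=
  smaller_coordinate fF1 fF2 neF (s_sorted a b as_ bs (ltnW ab)).
have /setDP[ui uF1] : u \in e i :\: F1 by rewrite e1 set11.
have /setDP[wi wF2] : w \in e i :\: F2 by rewrite e2 set11.
have uw : u != w by apply: contraTneq lt_uw => ->; rewrite ltnn.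
have uF2 : u \in F2.
  by apply: contraNT uw => uF2; rewrite -in_set1 -e2 inE uF2.
have duw := rank_dominates (dominates_total ui wi) (ltnW lt_uw).
(* The facet obtained from F2 by lowering its coordinate on e i to u has a
   smaller weight, so it occurs before F2. *)
have fF' := exchange_facet fF2 e2 ui uw duw.
have lt' := exchange_weight uF2 wF2 lt_uw.
set F' := _ :\ u in fF' lt'.
have F's : F' \in s by rewrite s_mem.
exists u; split; first by rewrite inE uF1.
exists (index F' s).
  rewrite ltnNge; apply: contraL lt' => le_b; rewrite -leqNgt.
  by have := s_sorted b (index F' s) bs; rewrite index_mem nth_index //; apply.
rewrite nth_index //; apply/setP => x; rewrite !inE.
have [->|xu] := eqVneq x u; first by rewrite uF2.
by have [xF2|xF2] := boolP (x \in F2); rewrite /= ?orbT ?andbF.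
Qed.

End Matching.

Theorem theorem2p16 (K : fieldType) (n : nat) (E : {set {set 'I_n}})
    (g : nat) (e : 'I_g -> {set 'I_n}) :
  clutter E ->
  konig_perfect_matching K E e ->
  (forall f1 f2 : {set 'I_n}, f1 \in E -> f2 \in E -> forall i : 'I_g,
      f1 :&: e i \subset f2 :&: e i \/ f2 :&: e i \subset f1 :&: e i) ->
  pure_shellable (independence_complex E).
Proof.
move=> _ [eE e_disj e_cover _] e_chain; split.
  exact: (pure_independence eE e_disj e_cover e_chain).
exact: (shellable_independence eE e_disj e_cover e_chain).
Qed.
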